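(* Let $n,m,p\ge1$ be integers and let $\Theta=(A,B,C)\in N$. The orthogonal projection $P_\Theta:T_\Theta N\to\mathcal{H}_\Theta$ onto the horizontal space $\mathcal{H}_\Theta$ is given, for $\eta=(a,b,c)\in T_\Theta N$, by $$P_\Theta(\eta)=\eta+(XA-AX,\;XB,\;-CX),$$ where $X$ is the skew-symmetric solution to the linear matrix equation $$\mathcal{L}_1(X)+2\mathcal{L}_0(X)+\beta=0,$$ with the linear maps $\mathcal{L}_0,\mathcal{L}_1:\mathbf{R}^{n\times n}\to\mathbf{R}^{n\times n}$ defined by $$\mathcal{L}_0(X)=AXA^{-1}+A^{-1}XA-2X,\qquad \mathcal{L}_1(X)=(BB^\top+C^\top C)X+X(BB^\top+C^\top C),$$ and $\beta=2\,\mathrm{sk}(2A^{-1}a+bB^\top+c^\top C)$.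
   Context: $\mathrm{sk}(Y)=\frac{Y-Y^\top}{2}$ is the skew-symmetric part of a square matrix $Y$. $\mathrm{Sym}_+(n)$ is the manifold of symmetric positive-definite real $n\times n$ matrices; $M=\mathrm{Sym}_+(n)\times\mathbf{R}^{n\times m}\times\mathbf{R}^{p\times n}$. A triple $(A,B,C)$ is controllable (resp. observable) if the discrete-time system $\hat x_{k+1}=A\hat x_k+B\hat u_k$, $\hat y_k=C\hat x_k$ is controllable (resp. observable). $N$ is the set of $\Theta=(A,B,C)\in M$ that are controllable and observable; it is open in $M$, so $T_\Theta N\cong\mathrm{Sym}(n)\times\mathbf{R}^{n\times m}\times\mathbf{R}^{p\times n}$, where $\mathrm{Sym}(n)$ is the space of symmetric real $n\times n$ matrices. The orthogonal group $O(n)$ acts on $N$ by $U\circ\Theta=(U^{\top}AU,U^{\top}B,CU)$; $[\Theta]$ denotes the orbit of $\Theta$, and $\pi:N\to N/O(n)$, $\pi(\Theta)=[\Theta]$, is the canonical projection onto the quotient manifold. The Riemannian metric on $N$ is $$\langle(\xi_1,\eta_1,\zeta_1),(\xi_2,\eta_2,\zeta_2)\rangle_\Theta=\mathrm{tr}(A^{-1}\xi_1A^{-1}\xi_2)+\mathrm{tr}(\eta_1^\top\eta_2)+\mathrm{tr}(\zeta_1^\top\zeta_2),\qquad \Theta=(A,B,C).$$ The vertical space is $\mathcal{V}_\Theta=T_\Theta\pi^{-1}([\Theta])\subset T_\Theta N$ (the tangent space of the orbit through $\Theta$), and the horizontal space $\mathcal{H}_\Theta$ is its orthogonal complement in $T_\Theta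 N$ with respect to this metric; orthogonality of the projection refers to this metric. *)

(* Defs.v *)
From HB Require Import structures.
From mathcomp Require Import all_boot all_order all_algebra.
From mathcomp Require Import all_classical all_reals all_analysis.
Set Implicit Arguments.
Unset Strict Implicit.
Unset Printing Implicit Defensive.
Import Order.TTheory GRing.Theory Num.Theory.
Import numFieldNormedType.Exports.
Local Open Scope classical_set_scope.
Local Open Scope ring_scope.

Section SystemManifold.
Variables (R : realType) (n m p : nat).

(* Ambient vector space containing both the triples (A, B, C) and, through the
   identification of T_Theta N with Sym(n) x R^(n x m) x R^(p x n), their
   tangent vectors (a, b, c). *)
Definition triple : Type := ('M[R]_n * 'M[R]_(n, m) * 'M[R]_(p, n))%type.

Definition sk (Y : 'M[R]_n) : 'M[R]_n := 2^-1 *: (Y - Y^T).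

Definition symmetric_mx (A : 'M[R]_n) : Prop := A^T = A.

Definition spd_mx (A : 'M[R]_n) : Prop :=
  symmetric_mx A /\ forall x : 'cV[R]_n, x != 0 -> 0 < (x^T *m A *m x) 0 0.

Fixpoint state (A : 'M[R]_n) (B : 'M[R]_(n, m)) (u : nat -> 'cV[R]_m)
    (x0 : 'cV[R]_n) (k : nat) : 'cV[R]_n :=
  if k is k'.+1 then A *m state A B u x0 k' + B *m u k' else x0.

Definition output (Theta : triple) (u : nat -> 'cV[R]_m)
    (x0 : 'cV[R]_n) (k : nat) : 'cV[R]_p :=
  let: (A, B, C) := Theta in C *m state A B u x0 k.

(* Any state can be steered to any other one in finite time. *)
Definition controllable (Theta : triple) : Prop :=
  let: (A, B, C) := Theta in
  forall x0 xf : 'cV[R]_n,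
    exists (T : nat) (u : nat -> 'cV[R]_m), state A B u x0 T = xf.

(* The initial state is determined by the inputs and outputs over some finite
   horizon. *)
Definition observable (Theta : triple) : Prop :=
  exists T : nat, forall (u : nat -> 'cV[R]_m) (x0 x0' : 'cV[R]_n),
    (forall k, (k < T)%N -> output Theta u x0 k = output Theta u x0' k) ->
    x0 = x0'.

Definition manifold_N : set triple :=
  [set Theta | [/\ spd_mx Theta.1.1, controllable Theta & observable Theta]].

Definition orthogonal_mx (U : 'M[R]_n) : Prop := U^T *m U = 1%:M.

Definition act (U : 'M[R]_n) (Theta : triple) : triple :=
  let: (A, B, C) := Theta in (U^T *m A *m U, U^T *m B, C *m U).

(* As a subset of N, the fibre of the projection N -> N/O(n) through Theta. *)
Definition orbit (Theta : triple) : set triple :=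
  [set Theta' | exists2 U, orthogonal_mx U & Theta' = act U Theta].

Definition tangent_N : set triple := [set xi | symmetric_mx xi.1.1].

Definition metric (Theta xi1 xi2 : triple) : R :=
  let: (A, B, C) := Theta in
  let: (a1, b1, c1) := xi1 in
  let: (a2, b2, c2) := xi2 in
  \tr (invmx A *m a1 *m invmx A *m a2) + \tr (b1^T *m b2) + \tr (c1^T *m c2).

Definition smooth_curve (gamma : R -> triple) : Prop :=
  forall (k : nat) (t : R), derivable (derive1n k gamma) t 1.

(* Tangent space of the orbit at Theta: the velocities at time 0 of the smooth
   curves that lie in the orbit and pass through Theta at time 0. *)
Definition vertical (Theta : triple) : set triple :=
  [set xi | exists gamma : R -> triple,
     [/\ smooth_curve gamma, forall t, orbit Theta (gamma t),
         gamma 0 = Theta & derive1 gamma 0 = xi]].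

Definition horizontal (Theta : triple) : set triple :=
  [set xi | tangent_N xi /\
     forall v, vertical Theta v -> metric Theta xi v = 0].

(* Only the values of P on T_Theta N matter. *)
Definition is_horizontal_projection (Theta : triple) (P : triple -> triple) :
    Prop :=
  forall eta, tangent_N eta ->
    horizontal Theta (P eta) /\
    forall h, horizontal Theta h -> metric Theta (eta - P eta) h = 0.

Definition L0 (A X : 'M[R]_n) : 'M[R]_n :=
  A *m X *m invmx A + invmx A *m X *m A - 2 *: X.

Definition L1 (B : 'M[R]_(n, m)) (C : 'M[R]_(p, n)) (X : 'M[R]_n) : 'M[R]_n :=
  (B *m B^T + C^T *m C) *m X + X *m (B *m B^T + C^T *m C).

Definition beta (Theta eta : triple) : 'M[R]_n :=
  let: (A, B, C) := Theta in
  let: (a, b, c) := eta in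
  2 *: sk (2 *: (invmx A *m a) + b *m B^T + c^T *m C).

Definition skew_solution (Theta eta : triple) (X : 'M[R]_n) : Prop :=
  let: (A, B, C) := Theta in
  X^T = - X /\ L1 B C X + 2 *: L0 A X + beta Theta eta = 0.

End SystemManifold.

(* Main.v *)
From HB Require Import structures.
Require Import Defs.
From mathcomp Require Import all_boot all_order all_algebra.
From mathcomp Require Import all_classical all_reals all_analysis.
From mathcomp Require Import ring lra.
Import Order.TTheory GRing.Theory Num.Theory.
Import numFieldNormedType.Exports.
Set Implicit Arguments.
Unset Strict Implicit.
Unset Printing Implicit Defensive.
Local Open Scope classical_set_scope.
Local Open Scope ring_scope.

(** For a skew-symmetric X, write v(X) = (XA - AX, XB, -CX).  The projection
formula is the solution of a linear least-squares problem: the vertical space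
is the range of v, so projecting eta onto its orthogonal complement means
finding X with eta + v(X) orthogonal to every v(Y), and the matrix equation
in X is the corresponding normal equation.

Two computations make this precise.  Since a is symmetric, the product of
(a, b, c) with v(Y) is - 1/2 tr(beta Y) ([metric_velocity]), so a tangent
vector is horizontal iff its beta vanishes ([horizontalP]).  Moreover beta is
linear and sends v(X) to L1 X + 2 L0 X ([beta_velocity]), so that the equation
says exactly that eta + v(X) is horizontal.

The equation has one solution because X |-> L1 X + 2 L0 X is bijective on all
matrices: tr(X^T (L1 X + 2 L0 X)) is a sum of nonnegative terms whose vanishing
forces AX = XA and XB = 0; such an X kills every state reachable from 0, hence
is 0 by controllability ([normal_op_eq0]).  The operator commutes with
transposition and the right-hand side is skew, so the solution is skew.

It remains to identify the vertical space, whose definition only speaks of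
smooth curves in the orbit.  Every v(X) is a velocity: the Cayley transform
gives a curve of orthogonal matrices with rational entries, hence smooth, and
with any prescribed skew derivative at 0 ([velocity_vertical]).  Conversely, a
smooth curve in the orbit is t |-> act (U t) Theta for some orthogonal U t on
which no regularity is known.  Controllability supplies it: each basis vector is
a state reached from 0 under Theta with some inputs, and these same inputs drive
the transformed system to the image of that vector under (U t)^T.  The entries
of U t are thus polynomial in the transformed system, so U is differentiable
and the product rule applies ([vertical_velocity]). *)

(** * Derivatives of pairs and matrices *)

Section Derivatives.
Variable R : realType.

Lemma is_derive_cvgP (V W : normedModType R) (f : V -> W) a v df :
  is_derive a v f df <->
  h^-1 *: (f (h *: v + a) - f a) @[h --> (0 : R)^'] --> df.
Proof.
split=> [[fa <-]|fa]; first exact: fa.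
by split; [apply/cvg_ex; exists df | exact: cvg_lim fa].
Qed.

Lemma is_derive_mxP (V : normedModType R) m n (F : V -> 'M[R]_(m, n)) t v dF :
  is_derive t v F dF <->
  forall i j, is_derive t v (fun s => F s i j) (dF i j).
Proof.
split=> [[Ft <-] i j|Fij].
  split; last by rewrite derive_mx // mxE.
  by move: Ft => /derivable_mxP.
have Ft : derivable F t v by apply/derivable_mxP => i j; exact: ex_derive.
split=> //; rewrite derive_mx //; apply/matrixP => i j; rewrite mxE.
exact: derive_val.
Qed.

Lemma is_derive_pairP (U V W : normedModType R) (f : U -> V) (g : U -> W)
    t v df dg :
  is_derive t v (fun s => (f s, g s)) (df, dg) <->
  is_derive t v f df /\ is_derive t v g dg.
Proof.
rewrite !is_derive_cvgP; split=> [fg|[ft gt]]; last exact: cvg_pair.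
split.
  exact: (cvg_comp _ _ fg (cvg_fst (F := nbhs df) (G := nbhs dg))).
exact: (cvg_comp _ _ fg (cvg_snd (F := nbhs df) (G := nbhs dg))).
Qed.

Lemma is_derive_mulmx (V : normedModType R) m n p (F : V -> 'M[R]_(m, n))
    (G : V -> 'M[R]_(n, p)) t v dF dG :
  is_derive t v F dF -> is_derive t v G dG ->
  is_derive t v (fun s => F s *m G s) (dF *m G t + F t *m dG).
Proof.
move=> /is_derive_mxP dFt /is_derive_mxP dGt; apply/is_derive_mxP => i j.
have -> : (fun s => (F s *m G s) i j) =
    \sum_(k < n) ((fun s => F s i k) * (fun s => G s k j)).
  by apply/funext => s; rewrite mxE fct_sumE.
apply: is_derive_eq.
rewrite !mxE -big_split; apply: eq_bigr => k _ /=.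
by rewrite /GRing.scale /= addrC; congr (_ + _); rewrite mulrC.
Qed.

Lemma is_derive_trmx (V : normedModType R) m n (F : V -> 'M[R]_(m, n)) t v dF :
  is_derive t v F dF -> is_derive t v (fun s => (F s)^T) dF^T.
Proof.
move=> /is_derive_mxP dFt; apply/is_derive_mxP => i j; rewrite mxE.
by have -> : (fun s => (F s)^T i j) = (fun s => F s j i)
  by apply/funext => s; rewrite mxE.
Qed.

End Derivatives.

(** * Curves with rational entries are smooth *)

Section Smooth.
Variable R : realType.

(** Smoothness of a whole class of functions at once: no formula for the higher
derivatives is needed when the class is stable under one derivation. *)
Lemma smooth_of_derive_closed (W : normedModType R) (S : set (R -> W)) :
  (forall f, S f -> exists2 g, S g & forall t, is_derive (t : R) 1 f (g t)) ->
  forall f, S f -> forall k t, derivable (derive1n k f) t 1.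
Proof.
move=> Sd f Sf k.
have Sfk : S (derive1n k f).
  elim: k => //= k /Sd[g Sg gE]; suff -> : derive1 (derive1n k f) = g by [].
  by apply/funext => t; rewrite derive1E; exact: derive_val.
by have [g _ gE] := Sd _ Sfk => t; exact: ex_derive.
Qed.

(** The denominator is required to be a power of a fixed q, so that one
hypothesis on q rules out all poles and derivatives stay in the class. *)
Definition rational (q : {poly R}) (f : R -> R) :=
  exists (k : nat) (P : {poly R}), forall t, f t = P.[t] / q.[t] ^+ k.

Definition rational_mx q m n (F : R -> 'M[R]_(m, n)) :=
  forall i j, rational q (fun t => F t i j).

Section Denominator.
Variable q : {poly R}.
Hypothesis q_neq0 : forall t, q.[t] != 0.

Lemma rational_poly (P : {poly R}) : rational q (horner P).
Proof. by exists 0, P => t; rewrite expr0 divr1. Qed.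

Lemma rational_cst c : rational q (fun=> c).
Proof. by exists 0, c%:P => t; rewrite hornerC expr0 divr1. Qed.

Lemma rationalD f g :
  rational q f -> rational q g -> rational q (fun t => f t + g t).
Proof.
move=> [k [P fE]] [l [S gE]]; exists (k + l)%N, (P * q ^+ l + S * q ^+ k) => t.
rewrite fE gE !hornerE addf_div ?expf_neq0 //.
by rewrite exprD.
Qed.

Lemma rationalM f g :
  rational q f -> rational q g -> rational q (fun t => f t * g t).
Proof.
move=> [k [P fE]] [l [S gE]]; exists (k + l)%N, (P * S) => t.
by rewrite fE gE hornerM exprD mulf_div.
Qed.

Lemma rational_sum (I : Type) (s : seq I) (f : I -> R -> R) :
  (forall i, rational q (f i)) -> rational q (fun t => \sum_(i <- s) f i t).
Proof.
move=> fq; elim: s => [|i s IHs].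
  have -> : (fun t => \sum_(i <- [::]) f i t) = (fun=> 0).
    by apply/funext => t; rewrite big_nil.
  exact: rational_cst.
have -> : (fun t => \sum_(j <- i :: s) f j t) =
          (fun t => f i t + \sum_(j <- s) f j t).
  by apply/funext => t; rewrite big_cons.
exact: rationalD.
Qed.

Lemma rational_derive f : rational q f ->
  exists2 g, rational q g & forall t, is_derive (t : R) 1 f (g t).
Proof.
move=> [k [P fE]].
pose N := P^`() * q - k%:R *: (P * q^`()).
exists (fun t => N.[t] / q.[t] ^+ k.+1); first by exists k.+1, N.
move=> t.
have -> : f = horner P * (fun s => (horner (q ^+ k) s)^-1).
  by apply/funext => s; rewrite fE -horner_exp.
have qk0 : horner (q ^+ k) t != 0 by rewrite horner_exp expf_neq0.
have dP := is_derive_poly P t.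
have dV := is_deriveV qk0 (is_derive_poly (q ^+ k) t).
apply: is_derive_eq (is_deriveM dP dV) _.
rewrite deriv_exp !hornerE hornerMn hornerM /GRing.scale /= -mulr_natr.
have := q_neq0 t; case: k {fE N qk0 dV} => [|k] q0.
  by rewrite expr0 expr1; field.
by rewrite horner_exp -[k.+1%:R]natr1 !exprS /=; field; rewrite q0 expf_neq0.
Qed.

Lemma rational_mx_cst m n (M : 'M[R]_(m, n)) : rational_mx q (fun=> M).
Proof. by move=> i j; exact: rational_cst. Qed.

Lemma rational_mxM m n p (F : R -> 'M[R]_(m, n)) (G : R -> 'M[R]_(n, p)) :
  rational_mx q F -> rational_mx q G -> rational_mx q (fun t => F t *m G t).
Proof.
move=> Fq Gq i j.
have -> : (fun t => (F t *m G t) i j) =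
          (fun t => \sum_k F t i k * G t k j).
  by apply/funext => t; rewrite mxE.
by apply: rational_sum => k; exact: rationalM.
Qed.

Lemma rational_mx_tr m n (F : R -> 'M[R]_(m, n)) :
  rational_mx q F -> rational_mx q (fun t => (F t)^T).
Proof.
move=> Fq i j.
by have -> : (fun s => (F s)^T i j) = (fun s => F s j i)
  by apply/funext => s; rewrite mxE.
Qed.

Lemma rational_mx_derive m n (F : R -> 'M[R]_(m, n)) : rational_mx q F ->
  exists2 G, rational_mx q G & forall t, is_derive (t : R) 1 F (G t).
Proof.
move=> Fq.
pose g i j := sval (cid2 (rational_derive (Fq i j))).
exists (fun t => \matrix_(i, j) g i j t) => [i j|t].
  have -> : (fun t => (\matrix_(i, j) g i j t) i j) = g i j.
    by apply/funext => t; rewrite mxE.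
  by rewrite /g; case: cid2.
apply/is_derive_mxP => i j; rewrite mxE /g; case: cid2 => //.
Qed.

Lemma rational_triple_smooth n m p (F : R -> 'M[R]_n) (G : R -> 'M[R]_(n, m))
    (H : R -> 'M[R]_(p, n)) :
  rational_mx q F -> rational_mx q G -> rational_mx q H ->
  smooth_curve (fun t => (F t, G t, H t) : triple R n m p).
Proof.
move=> Fq Gq Hq.
pose S : set (R -> triple R n m p) := [set gamma |
  [/\ rational_mx q (fun t => (gamma t).1.1),
      rational_mx q (fun t => (gamma t).1.2) &
      rational_mx q (fun t => (gamma t).2)]].
apply: (@smooth_of_derive_closed _ S) => // gamma [].
move=> /rational_mx_derive[F' F'q dF] /rational_mx_derive[G' G'q dG].
move=> /rational_mx_derive[H' H'q dH].
exists (fun t => (F' t, G' t, H' t)) => // t.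
have -> : gamma = fun s => ((gamma s).1.1, (gamma s).1.2, (gamma s).2).
  by apply/funext => s; case: (gamma s) => -[].
by apply/is_derive_pairP; split => //; apply/is_derive_pairP.
Qed.

End Denominator.

End Smooth.

(** * Positive definite matrices and trace forms *)

Section TraceForm.
Variable R : realType.

Lemma mxtrace_trmulE m n (Y : 'M[R]_(m, n)) :
  \tr (Y^T *m Y) = \sum_j \sum_i Y i j ^+ 2.
Proof.
apply: eq_bigr => j _; rewrite mxE; apply: eq_bigr => i _.
by rewrite mxE expr2.
Qed.

Lemma mxtrace_trmul_ge0 m n (Y : 'M[R]_(m, n)) : 0 <= \tr (Y^T *m Y).
Proof.
by rewrite mxtrace_trmulE; do 2! (apply: sumr_ge0 => ? _); exact: sqr_ge0.
Qed.

Lemma mxtrace_trmul_eq0 m n (Y : 'M[R]_(m, n)) : \tr (Y^T *m Y) = 0 -> Y = 0.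
Proof.
move=> /eqP; rewrite mxtrace_trmulE psumr_eq0 => [/allP Y0|j _]; last first.
  by apply: sumr_ge0 => i _; exact: sqr_ge0.
apply/matrixP => i j; rewrite mxE.
have /= := Y0 j (mem_index_enum _); rewrite psumr_eq0 => [/allP Yj0|? _].
  by apply/eqP; rewrite -sqrf_eq0; exact: Yj0 (mem_index_enum i).
exact: sqr_ge0.
Qed.

(** Block elimination.  The first diagonal entry d is positive, and the Schur
complement S of d is again positive definite: its form at y is the
minimum over s of the form of A at (s, y). *)
Lemma cholesky n (A : 'M[R]_n) :
  spd_mx A -> exists2 G : 'M[R]_n, G \in unitmx & A = G *m G^T.
Proof.
elim: n A => [|n IHn] A [Asym].
  exists 1%:M; first exact: unitmx1.
  by apply/matrixP => -[].
change ('M[R]_(1 + n)) in A; rewrite -[n.+1]/(1 + n)%N => Apos.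
pose d := A 0 0; pose c : 'cV[R]_n := dlsubmx A; pose D : 'M[R]_n := drsubmx A.
have ulA : ulsubmx A = d%:M.
  by rewrite [LHS]mx11_scalar !mxE; congr (A _ _)%:M; apply/val_inj.
have urA : ursubmx A = c^T by rewrite /c trmx_dlsub Asym.
have Dsym : D^T = D by rewrite /D trmx_drsub Asym.
have AE : A = block_mx d%:M c^T c D by rewrite -ulA -urA submxK.
have quadE (s : R) (y : 'cV[R]_n) :
    let x : 'cV[R]_(1 + n) := col_mx s%:M y in
    (x^T *m A *m x) 0 0 =
    d * s ^+ 2 + 2 * s * (c^T *m y) 0 0 + (y^T *m D *m y) 0 0.
  rewrite /= {1}AE tr_col_mx mul_row_block mul_row_col tr_scalar_mx.
  rewrite !mulmxDl -!scalar_mxM mul_scalar_mx mul_mx_scalar -scalemxAl.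
  have -> : y^T *m c = (c^T *m y)^T by rewrite trmx_mul trmxK.
  rewrite !mxE eqxx mulr1n; set u := \sum_j _; set v := \sum_j _; ring.
have d_gt0 : 0 < d.
  have := Apos (col_mx 1%:M 0 : 'cV[R]_(1 + n)); rewrite quadE.
  rewrite expr1n !mulmx0 !mxE mulr0 !addr0 mulr1; apply.
  by rewrite col_mx_eq0 negb_and matrix_nonzero1.
pose S := D - d^-1 *: (c *m c^T).
have Sspd : spd_mx S.
  split.
    by rewrite /symmetric_mx linearB /= linearZ /= trmx_mul trmxK Dsym.
  move=> y yn0.
  (* The minimizing s is the root of the derivative in s. *)
  pose s := - (d^-1 * (c^T *m y) 0 0).
  have := Apos (col_mx s%:M y : 'cV[R]_(1 + n)); rewrite quadE.
  rewrite col_mx_eq0 negb_and yn0 orbT => /(_ isT).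
  congr (_ < _).
  have -> : (y^T *m S *m y) 0 0 =
      (y^T *m D *m y) 0 0 - d^-1 * (c^T *m y) 0 0 ^+ 2.
    rewrite /S mulmxBr mulmxBl -scalemxAr -scalemxAl.
    rewrite [LHS]mxE; congr (_ + _); rewrite [LHS]mxE [in LHS]mxE.
    have -> : y^T *m (c *m c^T) *m y = (c^T *m y)^T *m (c^T *m y).
      by rewrite trmx_mul trmxK !mulmxA.
    by rewrite [c^T *m y]mx11_scalar tr_scalar_mx -scalar_mxM !mxE eqxx expr2.
  by rewrite /s; field; rewrite gt_eqF.
have [G Gu SE] := IHn S Sspd.
pose r := Num.sqrt d.
have r_gt0 : 0 < r by rewrite sqrtr_gt0.
have r2 : r * r = d by rewrite -expr2 sqr_sqrtr // ltW.
exists (block_mx r%:M 0 (r^-1 *: c) G).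
  rewrite unitmxE det_lblock unitrM -!unitmxE Gu andbT.
  by rewrite unitmxE det_scalar1 unitfE gt_eqF.
rewrite AE tr_block_mx mulmx_block tr_scalar_mx !trmx0 !mulmx0 !mul0mx !addr0.
rewrite -scalar_mxM r2 linearZ /=.
rewrite mul_scalar_mx scalerA mulfV ?gt_eqF // scale1r.
rewrite mul_mx_scalar scalerA mulfV ?gt_eqF // scale1r.
rewrite -SE -scalemxAl -scalemxAr scalerA -invfM r2.
by rewrite /S [_ *: _ + _]addrC subrK.
Qed.

(** Through Cholesky factors, the form of the affine-invariant metric becomes
a squared Frobenius norm. *)
Lemma mxtrace_spd_formE m n (G : 'M[R]_m) (H : 'M[R]_n) (Y : 'M[R]_(m, n)) :
  \tr ((H *m H^T) *m Y^T *m (G *m G^T) *m Y) =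
  \tr ((G^T *m Y *m H)^T *m (G^T *m Y *m H)).
Proof. by rewrite !trmx_mul trmxK -!mulmxA mxtrace_mulC -!mulmxA. Qed.

Lemma mxtrace_spd_form_ge0 n (Q Y : 'M[R]_n) :
  spd_mx Q -> 0 <= \tr (Q *m Y^T *m Q *m Y).
Proof.
by move=> /cholesky[G _ ->]; rewrite mxtrace_spd_formE mxtrace_trmul_ge0.
Qed.

Lemma mxtrace_spd_form_eq0 n (Q Y : 'M[R]_n) :
  spd_mx Q -> \tr (Q *m Y^T *m Q *m Y) = 0 -> Y = 0.
Proof.
move=> /cholesky[G Gu ->]; rewrite mxtrace_spd_formE => /mxtrace_trmul_eq0.
move=> /(congr1 (fun Z => invmx G^T *m Z *m invmx G)).
by rewrite mulmx0 mul0mx !mulmxA mulmxK // mulVmx ?unitmx_tr // mul1mx.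
Qed.

Lemma spd_unitmx n (A : 'M[R]_n) : spd_mx A -> A \in unitmx.
Proof.
by move=> /cholesky[G Gu ->]; rewrite unitmx_mul unitmx_tr Gu.
Qed.

Lemma spd_invmx n (A : 'M[R]_n) : spd_mx A -> spd_mx (invmx A).
Proof.
move=> Aspd; have Au := spd_unitmx Aspd; have [Asym Apos] := Aspd.
have Qsym : (invmx A)^T = invmx A by rewrite trmx_inv Asym.
split=> // x xn0.
have -> : x^T *m invmx A *m x = (invmx A *m x)^T *m A *m (invmx A *m x).
  by rewrite trmx_mul Qsym !mulmxA mulmxKV.
apply: Apos; apply: contra_neq xn0 => /(congr1 (mulmx A)).
by rewrite mulKVmx // mulmx0.
Qed.

(** A skew K has no nonzero real eigenvalue: v = vK gives
|v|^2 = vKv^T = - |v|^2. *)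
Lemma skew_1B_unitmx n (K : 'M[R]_n) : K^T = - K -> 1%:M - K \in unitmx.
Proof.
move=> Kskew; rewrite -row_free_unit -kermx_eq0; apply/rowV0P => v.
rewrite sub_kermx mulmxBr mulmx1 subr_eq0 => /eqP vE.
have vvE : \tr (v *m v^T) = - \tr (v *m v^T).
  rewrite {1}vE -mxtrace_tr !trmx_mul trmxK Kskew mulNmx mulmxN linearN /=.
  by rewrite mulmxA -vE.
have /mxtrace_trmul_eq0 /(congr1 trmx) : \tr (v^T^T *m v^T) = 0.
  by rewrite trmxK; lra.
by rewrite trmxK trmx0.
Qed.

End TraceForm.

(** * The normal equation *)

Section NormalOperator.
Variables (R : realType) (n m p : nat).
Variables (A : 'M[R]_n) (B : 'M[R]_(n, m)) (C : 'M[R]_(p, n)).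

(** The derivative at t = 0 of act (exp (- t X)) (A, B, C) for skew X; the sign
is the one of the projection formula. *)
Definition velocity (X : 'M[R]_n) : triple R n m p :=
  (X *m A - A *m X, X *m B, - (C *m X)).

(** The normal operator of the least-squares problem: on skew matrices it is, up
to a factor, the composite of [velocity] with its adjoint for the metric. *)
Definition normal_op (X : 'M[R]_n) : 'M[R]_n := L1 B C X + 2 *: L0 A X.

Lemma normal_op_linear : linear normal_op.
Proof.
move=> a X Z; rewrite /normal_op /L1 /L0 !(mulmxDr, mulmxDl).
rewrite -?scalemxAr -?scalemxAl.
by apply/matrixP => i j; rewrite !mxE; ring.
Qed.

HB.instance Definition _ :=
  GRing.isLinear.Build R 'M[R]_n 'M[R]_n _ normal_op normal_op_linear.

End NormalOperator.

Section Bijectivity.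
Variables (R : realType) (n m p : nat).
Variables (A : 'M[R]_n) (B : 'M[R]_(n, m)) (C : 'M[R]_(p, n)).
Hypothesis Aspd : spd_mx A.
Hypothesis ABC_controllable : controllable (A, B, C).

Let Au : A \in unitmx. Proof. exact: spd_unitmx. Qed.
Let Asym : A^T = A. Proof. by case: Aspd. Qed.
Let Qsym : (invmx A)^T = invmx A. Proof. by rewrite trmx_inv Asym. Qed.

Lemma velocity_tangent X : X^T = - X -> tangent_N (velocity A B C X).
Proof.
move=> Xskew; rewrite /tangent_N /velocity /symmetric_mx /=.
by rewrite linearB /= !trmx_mul Asym Xskew mulmxN mulNmx opprK addrC.
Qed.

(** X kills the states reachable from 0, which form the whole space. *)
Lemma comm_annihilator_eq0 X : A *m X = X *m A -> X *m B = 0 -> X = 0.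
Proof.
move=> AX XB.
have Xstate u k : X *m state A B u 0 k = 0.
  elim: k => [|k IHk] /=; first by rewrite mulmx0.
  by rewrite mulmxDr !mulmxA XB mul0mx addr0 -AX -mulmxA IHk mulmx0.
apply/matrixP => i j.
have [T [u uE]] := ABC_controllable 0 (delta_mx j 0).
have /(congr1 (fun M : 'cV_n => M i 0)) := Xstate u T.
by rewrite uE -colE !mxE.
Qed.

(** The right-hand side is the squared length of the commutator in the
affine-invariant metric, so L0 is positive semidefinite. *)
Lemma mxtrace_L0E X :
  \tr (X^T *m L0 A X) =
  \tr (invmx A *m (A *m X - X *m A)^T *m invmx A *m (A *m X - X *m A)).
Proof.
have -> : (A *m X - X *m A)^T = X^T *m A - A *m X^T.
  by rewrite linearB /= !trmx_mul Asym.
rewrite /L0 !(mulmxBr, mulmxBl, mulmxDr, mulmxN) opprB.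
rewrite !mxtraceD ![\tr (- _)]linearN /=.
rewrite -!scalemxAr mxtraceZ !mulmxA (mulVmx Au) mul1mx.
rewrite !(mulmxKV Au) !(mulmxK Au).
have -> : \tr (invmx A *m X^T *m A *m X) = \tr (X^T *m A *m X *m invmx A).
  by rewrite -!mulmxA mxtrace_mulC !mulmxA.
have -> : \tr (invmx A *m X^T *m X *m A) = \tr (X^T *m X).
  by rewrite -!mulmxA mxtrace_mulC !mulmxA mulmxK.
lra.
Qed.

(** L1 is positive semidefinite as well; the term in XB is the one that, with
the commutator, forces X = 0. *)
Lemma mxtrace_L1E X :
  \tr (X^T *m L1 B C X) =
  \tr ((B^T *m X)^T *m (B^T *m X)) + \tr ((C *m X)^T *m (C *m X)) +
  \tr ((X *m B)^T *m (X *m B)) + \tr ((C *m X^T)^T *m (C *m X^T)).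
Proof.
rewrite /L1 !(mulmxDl, mulmxDr) !linearD /= !trmx_mul !trmxK !mulmxA.
rewrite -!addrA; do 2!congr (_ + _); congr (_ + _).
  rewrite [RHS]mxtrace_mulC !mulmxA -[RHS]mxtrace_tr.
  by rewrite !trmx_mul !trmxK !mulmxA.
by rewrite [RHS]mxtrace_mulC !mulmxA.
Qed.

Lemma normal_op_eq0 X : normal_op A B C X = 0 -> X = 0.
Proof.
move=> /(congr1 (fun Y => \tr (X^T *m Y))); rewrite mulmx0 linear0.
rewrite /normal_op mulmxDr -scalemxAr linearD linearZ /=.
rewrite mxtrace_L1E mxtrace_L0E.
have := mxtrace_trmul_ge0 (B^T *m X).
have := mxtrace_trmul_ge0 (C *m X).
have := mxtrace_trmul_ge0 (X *m B).
have := mxtrace_trmul_ge0 (C *m X^T).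
have := mxtrace_spd_form_ge0 (A *m X - X *m A) (spd_invmx Aspd).
set q := \tr (_ *m _ *m _ *m _); set u := \tr _; set v := \tr _.
set w := \tr _; set z := \tr _ => q0 u0 v0 w0 z0 s0.
have /(mxtrace_spd_form_eq0 (spd_invmx Aspd)) /eqP : q = 0 by lra.
rewrite subr_eq0 => /eqP AX.
apply: comm_annihilator_eq0 => //; apply: mxtrace_trmul_eq0.
by rewrite -/v; lra.
Qed.

Lemma normal_op_tr X : (normal_op A B C X)^T = normal_op A B C X^T.
Proof.
rewrite /normal_op /L1 /L0 !(linearD, linearN, linearZ) /=.
rewrite !trmx_mul !linearD /= !trmx_mul !trmxK Asym Qsym !mulmxA.
by rewrite mulmxDl; congr (_ + (_ + _)); rewrite addrC.
Qed.

Lemma normal_op_inj : injective (normal_op A B C).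
Proof.
move=> X Y XY; apply/eqP; rewrite -subr_eq0; apply/eqP/normal_op_eq0.
by rewrite linearB /= XY subrr.
Qed.

Lemma normal_op_surj Y : exists X, normal_op A B C X = Y.
Proof.
have ker0 : lker (linfun (normal_op A B C)) == 0%VS.
  by apply/lker0P => X Z; rewrite !lfunE /=; exact: normal_op_inj.
exists ((linfun (normal_op A B C))^-1%VF Y).
by have := lker0_lfunVK ker0 Y; rewrite lfunE.
Qed.

End Bijectivity.

(** * The metric and the map beta *)

Section MetricTheory.
Variables (R : realType) (n m p : nat).
Variables (A : 'M[R]_n) (B : 'M[R]_(n, m)) (C : 'M[R]_(p, n)).
Let Theta : triple R n m p := (A, B, C).

Lemma metricC x y : metric Theta x y = metric Theta y x.
Proof.
case: x y => [[a b] c] [[a' b'] c'] /=; congr (_ + _ + _).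
- by rewrite -!mulmxA mulmxA mxtrace_mulC !mulmxA.
- by rewrite -mxtrace_tr trmx_mul trmxK.
- by rewrite -mxtrace_tr trmx_mul trmxK.
Qed.

Lemma metricBl x y z :
  metric Theta (x - y) z = metric Theta x z - metric Theta y z.
Proof.
case: x y z => [[a b] c] [[a' b'] c'] [[a'' b''] c''].
rewrite -[_ - _]/(a - a', b - b', c - c') /=.
rewrite !linearB /= !(mulmxBl, mulmxBr) /= ![\tr (_ - _)]linearB /=.
ring.
Qed.

Lemma betaE a b c : beta Theta (a, b, c) =
  (2 *: (invmx A *m a) + b *m B^T + c^T *m C) -
  (2 *: (invmx A *m a) + b *m B^T + c^T *m C)^T.
Proof. by rewrite /beta /sk /= scalerA mulfV ?scale1r. Qed.

Lemma betaD x y : beta Theta (x + y) = beta Theta x + beta Theta y.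
Proof.
case: x y => [[a b] c] [[a' b'] c'].
rewrite -[_ + _]/(a + a', b + b', c + c') !betaE.
rewrite [(c + c')^T]linearD /= !(mulmxDr, mulmxDl).
by apply/matrixP => i j; rewrite !mxE; ring.
Qed.

Lemma tangentD (x y : triple R n m p) :
  tangent_N x -> tangent_N y -> tangent_N (x + y).
Proof. by rewrite /tangent_N /= /symmetric_mx linearD /= => -> ->. Qed.

Lemma tangentB (x y : triple R n m p) :
  tangent_N x -> tangent_N y -> tangent_N (x - y).
Proof. by rewrite /tangent_N /= /symmetric_mx linearB /= => -> ->. Qed.

Hypothesis Aspd : spd_mx A.
Let Au : A \in unitmx. Proof. exact: spd_unitmx. Qed.
Let Asym : A^T = A. Proof. by case: Aspd. Qed.
Let Qsym : (invmx A)^T = invmx A. Proof. by rewrite trmx_inv Asym. Qed.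

Lemma metric_eq0 x : tangent_N x -> metric Theta x x = 0 -> x = 0.
Proof.
case: x => [[a b] c]; rewrite /tangent_N /symmetric_mx /= => asym.
have := mxtrace_spd_form_ge0 a (spd_invmx Aspd).
have := mxtrace_trmul_ge0 b; have := mxtrace_trmul_ge0 c.
rewrite asym => c0 b0 a0 abc0.
have b1 : \tr (b^T *m b) = 0 by lra.
have c1 : \tr (c^T *m c) = 0 by lra.
have a1 : \tr (invmx A *m a^T *m invmx A *m a) = 0 by rewrite asym; lra.
by rewrite (mxtrace_trmul_eq0 b1) (mxtrace_trmul_eq0 c1)
  (mxtrace_spd_form_eq0 (spd_invmx Aspd) a1).
Qed.

Lemma beta_skew x : (beta Theta x)^T = - beta Theta x.
Proof.
by case: x => [[a b] c]; rewrite betaE [LHS]linearB /= trmxK opprB.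
Qed.

(** The metric only sees the skew part of Z = 2 A^-1 a + b B^T + c^T C against a
skew Y.  The factor 2 in Z arises because both halves of the commutator
YA - AY contribute the same trace, as a is symmetric. *)
Lemma metric_velocity x Y : tangent_N x -> Y^T = - Y ->
  metric Theta x (velocity A B C Y) = - 2^-1 * \tr (beta Theta x *m Y).
Proof.
case: x => [[a b] c]; rewrite /tangent_N /symmetric_mx betaE /= => asym Yskew.
set Z := 2 *: _ + _ + _.
have -> : \tr ((Z - Z^T) *m Y) = 2 * \tr (Z *m Y).
  rewrite mulmxBl linearB /=.
  have -> : \tr (Z^T *m Y) = - \tr (Z *m Y).
    by rewrite -mxtrace_tr trmx_mul trmxK Yskew mulNmx linearN /= mxtrace_mulC.
  by ring.
rewrite mulrA mulNr mulVf // mulN1r /Z.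
rewrite !mulmxDl !mxtraceD -scalemxAl mxtraceZ mulmxBr.
rewrite linearB mulmxN linearN /=.
rewrite !mulmxA !(mulmxKV Au).
have -> : \tr (invmx A *m a *m invmx A *m Y *m A) = - \tr (invmx A *m a *m Y).
  rewrite mxtrace_mulC !mulmxA mulmxV // mul1mx.
  rewrite -mxtrace_tr !trmx_mul Qsym asym Yskew mulNmx linearN /=.
  by rewrite mxtrace_mulC.
have -> : \tr (b^T *m Y *m B) = - \tr (b *m B^T *m Y).
  rewrite -mxtrace_tr !trmx_mul trmxK Yskew mulNmx mulmxN linearN /=.
  by rewrite mulmxA mxtrace_mulC !mulmxA mxtrace_mulC !mulmxA.
ring.
Qed.

Lemma beta_velocity X :
  X^T = - X -> beta Theta (velocity A B C X) = normal_op A B C X.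
Proof.
move=> Xskew; rewrite betaE /normal_op /L1 /L0.
have -> : (- (C *m X))^T *m C = X *m C^T *m C.
  by rewrite linearN /= trmx_mul Xskew !mulNmx opprK.
rewrite mulmxBr !mulmxA mulVmx // mul1mx.
rewrite !linearD /= !linearZ /= !trmx_mul !trmxK Xskew.
rewrite [(- X)^T]linearN /= Xskew Asym Qsym.
rewrite !(mulNmx, mulmxN) !mulmxA !(mulmxDl, mulmxDr).
by apply/matrixP => i j; rewrite !mxE; ring.
Qed.

End MetricTheory.

(** * The tangent space of the orbit *)

Section VerticalSpace.
Variables (R : realType) (n m p : nat).
Variables (A : 'M[R]_n) (B : 'M[R]_(n, m)) (C : 'M[R]_(p, n)).
Let Theta : triple R n m p := (A, B, C).

Lemma is_derive_orthogonal_skew (U : R -> 'M[R]_n) dU :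
  (forall t, orthogonal_mx (U t)) -> U 0 = 1%:M -> is_derive (0 : R) 1 U dU ->
  dU^T = - dU.
Proof.
move=> Uorth U0 dUE.
have := is_derive_mulmx (is_derive_trmx dUE) dUE.
have -> : (fun s => (U s)^T *m U s) = cst 1%:M.
  by apply/funext => s; exact: Uorth.
move=> /(@derive_val _ _ _ _ _ _ _); rewrite derive_cst U0 trmx1 mulmx1 mul1mx.
by move=> /esym/eqP; rewrite addr_eq0 => /eqP.
Qed.

Lemma is_derive_act (U : R -> 'M[R]_n) dU :
  (forall t, orthogonal_mx (U t)) -> U 0 = 1%:M -> is_derive (0 : R) 1 U dU ->
  is_derive (0 : R) 1 (fun t => act (U t) Theta) (velocity A B C (- dU)).
Proof.
move=> Uorth U0 dUE; have dUskew := is_derive_orthogonal_skew Uorth U0 dUE.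
have dUT := is_derive_trmx dUE.
have dcst k l (M : 'M[R]_(k, l)) : is_derive (0 : R) 1 (fun=> M) 0.
  exact: is_derive_cst.
apply/is_derive_pairP; split; [apply/is_derive_pairP; split|].
- have dUTA := is_derive_mulmx dUT (dcst _ _ A).
  apply: is_derive_eq (is_derive_mulmx dUTA dUE) _.
  by rewrite U0 trmx1 mulmx1 mulmx0 addr0 mul1mx dUskew mulmxN opprK.
- apply: is_derive_eq (is_derive_mulmx dUT (dcst _ _ B)) _.
  by rewrite mulmx0 addr0 dUskew.
- apply: is_derive_eq (is_derive_mulmx (dcst _ _ C) dUE) _.
  by rewrite mul0mx add0r mulmxN opprK.
Qed.

(** A change of orthonormal coordinates transports trajectories. *)
Lemma state_act (U : 'M[R]_n) u k : orthogonal_mx U ->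
  state (U^T *m A *m U) (U^T *m B) u 0 k = U^T *m state A B u 0 k.
Proof.
move=> /mulmx1C UU; elim: k => [|k IHk] /=; first by rewrite mulmx0.
by rewrite IHk mulmxDr !mulmxA -(mulmxA _ U) UU mulmx1.
Qed.

Lemma derivable_state (F : R -> 'M[R]_n) (G : R -> 'M[R]_(n, m)) u k t :
  derivable F t 1 -> derivable G t 1 ->
  derivable (fun s => state (F s) (G s) u 0 k) t 1.
Proof.
move=> /derivableP dF /derivableP dG; elim: k => [|k IHk] /=.
  exact: derivable_cst.
have du : is_derive (t : R) 1 (fun=> u k) 0 by exact: is_derive_cst.
by case: (is_deriveD (is_derive_mulmx dF (derivableP IHk))
  (is_derive_mulmx dG du)).
Qed.

(** The orthogonal matrices U t are picked pointwise by choice; the columns of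
their transposes are recovered as states of the system gamma t, which makes U
differentiable at 0 and fixes U 0 = 1. *)
Lemma vertical_velocity xi : controllable Theta -> vertical Theta xi ->
  exists2 X, X^T = - X & xi = velocity A B C X.
Proof.
move=> Thetac [gamma [gamma_smooth gamma_orbit gamma0 dgamma]].
have [U UE] : {U : R -> 'M[R]_n | forall t, orthogonal_mx (U t) /\
    gamma t = act (U t) Theta}.
  exists (fun t => sval (cid2 (gamma_orbit t))) => t.
  by case: cid2.
have Uorth t : orthogonal_mx (U t) by case: (UE t).
have gammaE : gamma = fun t => act (U t) Theta.
  by apply/funext => t; case: (UE t).
have gamma_derive : is_derive (0 : R) 1 gamma xi.
  by split; [exact: (gamma_smooth 0%N 0) | rewrite -derive1E].
have [dF dG] : derivable (fun t => (gamma t).1.1) 0 1 /\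
               derivable (fun t => (gamma t).1.2) 0 1.
  move: gamma_derive.
  have -> : gamma = fun s => ((gamma s).1.1, (gamma s).1.2, (gamma s).2).
    by apply/funext => s; case: (gamma s) => [[]].
  case: xi {dgamma} => [[a b] c] /is_derive_pairP[/is_derive_pairP[da db] _].
  by split; apply: ex_derive.
have steer (j : 'I_n) : exists Tu : nat * (nat -> 'cV[R]_m),
    forall t, state (gamma t).1.1 (gamma t).1.2 Tu.2 0 Tu.1 =
              (U t)^T *m delta_mx j 0.
  have [T [u uE]] := Thetac 0 (delta_mx j 0).
  by exists (T, u) => t; rewrite gammaE /= state_act // uE.
have UTd : derivable (fun t => (U t)^T) 0 1.
  apply/derivable_mxP => i j; have [[T u] /= uE] := steer j.
  have -> : (fun t => (U t)^T i j) =
      (fun t => state (gamma t).1.1 (gamma t).1.2 u 0 T i 0).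
    by apply/funext => t; rewrite uE -colE [RHS]mxE.
  by have /derivable_mxP/(_ i 0) := derivable_state (u := u) (k := T) dF dG.
have Ud : is_derive (0 : R) 1 U ('D_1 (fun t => (U t)^T) 0)^T.
  have := is_derive_trmx (derivableP UTd).
  by have -> : (fun t => (U t)^T^T) = U by apply/funext => t; rewrite trmxK.
have U0 : U 0 = 1%:M.
  apply: trmx_inj; rewrite trmx1; apply/matrixP => i j.
  have [T [u uE]] := Thetac 0 (delta_mx j 0).
  have := state_act u T (Uorth 0).
  have := gamma0; rewrite gammaE => -[-> -> _]; rewrite uE -colE.
  by move=> /(congr1 (fun M : 'cV_n => M i 0)); rewrite !mxE eqxx andbT eq_sym.
have dU := is_derive_act Uorth U0 Ud.
have Xskew := is_derive_orthogonal_skew Uorth U0 Ud.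
exists (- ('D_1 (fun t => (U t)^T) 0)^T).
  by rewrite linearN /= Xskew.
by rewrite -(@derive_val _ _ _ _ _ _ _ dU) -gammaE derive_val.
Qed.

Section Cayley.
Variable K : 'M[R]_n.
Hypothesis Kskew : K^T = - K.

Let D t := 1%:M - t *: K.
Let E t := 1%:M + t *: K.

Let trD t : (D t)^T = E t.
Proof. by rewrite /D /E linearB /= trmx1 linearZ /= Kskew scalerN opprK. Qed.

Let Du t : D t \in unitmx.
Proof. by apply: skew_1B_unitmx; rewrite linearZ /= Kskew scalerN. Qed.

Let Eu t : E t \in unitmx. Proof. by rewrite -trD unitmx_tr Du. Qed.

Let DEC t : D t *m E t = E t *m D t.
Proof.
rewrite /D /E !(mulmxDl, mulmxDr, mulmxBr, mulmxN, mulNmx, mul1mx, mulmx1).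
by apply/matrixP => i j; rewrite !mxE; ring.
Qed.

(** Twice K is the derivative at 0.  The Cayley transform is used instead of the
exponential because its entries are rational. *)
Definition cayley t := invmx (D t) *m E t.

Lemma cayleyE t : (1%:M - t *: K) *m cayley t = 1%:M + t *: K.
Proof. by rewrite /cayley (mulKVmx (Du t)). Qed.

Lemma cayley_orthogonal t : orthogonal_mx (cayley t).
Proof.
rewrite /orthogonal_mx /cayley trmx_mul -[in X in X *m _ *m _]trD trmxK.
rewrite trmx_inv trD.
have -> : D t *m invmx (E t) = invmx (E t) *m D t.
  by rewrite -[LHS](mulKmx (Eu t)) (mulmxA (E t)) -DEC mulmxK ?Eu.
by rewrite -mulmxA (mulKVmx (Du t)) mulVmx ?Eu.
Qed.

Lemma cayley0 : cayley 0 = 1%:M.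
Proof. by rewrite /cayley /D /E scale0r subr0 addr0 invmx1 mulmx1. Qed.

(** The matrix D t with t replaced by the indeterminate: the determinant of D t
and the entries of its adjugate are then values of polynomials. *)
Definition cayley_poly : 'M[{poly R}]_n := 1%:M - 'X *: map_mx polyC K.

Lemma cayley_polyE t : map_mx (horner_eval t) cayley_poly = D t.
Proof.
by apply/matrixP => i j; rewrite !mxE /horner_eval !hornerE hornerMn hornerC.
Qed.

Definition cayley_den : {poly R} := \det cayley_poly.

Lemma cayley_denE t : cayley_den.[t] = \det (D t).
Proof. by rewrite -cayley_polyE det_map_mx. Qed.

Lemma cayley_den_neq0 t : cayley_den.[t] != 0.
Proof. by rewrite cayley_denE -unitfE -unitmxE Du. Qed.

Lemma cayley_rational : rational_mx cayley_den cayley.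
Proof.
apply: (rational_mxM cayley_den_neq0) => [i j|i j].
  exists 1%N, (\adj cayley_poly i j) => t; rewrite /invmx Du mxE.
  have -> : \adj (D t) = map_mx (horner_eval t) (\adj cayley_poly).
    by rewrite map_mx_adj cayley_polyE.
  by rewrite mxE expr1 cayley_denE mulrC.
have -> : (fun t => E t i j) =
          horner (((1%:M : 'M[R]_n) i j)%:P + 'X * (K i j)%:P).
  by apply/funext => t; rewrite !mxE !hornerE.
exact: rational_poly.
Qed.

End Cayley.

Lemma velocity_vertical X : X^T = - X -> vertical Theta (velocity A B C X).
Proof.
(* [act] sends U' = 2K to the velocity of - 2K. *)
move=> Xskew; pose K := - (2^-1 *: X).
have Kskew : K^T = - K by rewrite linearN linearZ /= Xskew scalerN.
have q0 := cayley_den_neq0 Kskew; have cq := cayley_rational Kskew.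
exists (fun t => act (cayley K t) Theta).
have [dU _ dUE] := rational_mx_derive q0 cq.
suff dU0 : dU 0 = - X.
  have dact := is_derive_act (cayley_orthogonal Kskew) (cayley0 K) (dUE 0).
  split.
  - apply: (rational_triple_smooth q0).
    + apply: rational_mxM => //; apply: rational_mxM => //;
        [exact: rational_mx_tr|exact: rational_mx_cst].
    + apply: rational_mxM => //; [exact: rational_mx_tr|exact: rational_mx_cst].
    + by apply: rational_mxM => //; exact: rational_mx_cst.
  - by move=> t; exists (cayley K t) => //; exact: cayley_orthogonal.
  - by rewrite cayley0 /= trmx1 !mul1mx !mulmx1.
  - by rewrite derive1E derive_val dU0 opprK.
have dN (M : 'M[R]_n) : is_derive (0 : R) 1 (fun t => 1%:M + t *: M) M.
  apply/is_derive_mxP => i j.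
  have -> : (fun t => (1%:M + t *: M) i j) =
            horner (((1%:M : 'M[R]_n) i j)%:P + 'X * (M i j)%:P).
    by apply/funext => t; rewrite !mxE !hornerE.
  apply: is_derive_eq (is_derive_poly _ _) _.
  by rewrite derivD derivM derivX !derivC !hornerE.
(* Differentiating (1 - t K) U = 1 + t K at 0 gives U' - K = K. *)
have := is_derive_mulmx (dN (- K)) (dUE 0).
have -> : (fun t => (1%:M + t *: - K) *m cayley K t) = (fun t => 1%:M + t *: K).
  by apply/funext => t; rewrite scalerN cayleyE.
move=> /(@derive_val _ _ _ _ _ _ _).
rewrite (@derive_val _ _ _ _ _ _ _ (dN K)) scale0r addr0 mul1mx cayley0 mulmx1.
move=> KE; have -> : dU 0 = K + K by rewrite {1}KE addrAC addNr add0r.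
by rewrite -opprD -scalerDl -[2^-1]mul1r -splitr scale1r.
Qed.

End VerticalSpace.

(** * Projection onto the horizontal space *)

Section Projection.
Variables (R : realType) (n m p : nat).
Variables (A : 'M[R]_n) (B : 'M[R]_(n, m)) (C : 'M[R]_(p, n)).
Let Theta : triple R n m p := (A, B, C).
Hypothesis Aspd : spd_mx A.
Hypothesis Theta_controllable : controllable Theta.

(** For the direct implication, x is tested on the vertical vector given by its
own beta. *)
Lemma horizontalP x : tangent_N x -> horizontal Theta x <-> beta Theta x = 0.
Proof.
move=> xT; split=> [[_ xV]|x0].
  have := xV _ (velocity_vertical A B C (beta_skew A B C x)).
  rewrite metric_velocity //; last exact: beta_skew.
  move=> b0; apply: mxtrace_trmul_eq0.
  by rewrite beta_skew mulNmx linearN /=; lra.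
split=> // v /(vertical_velocity Theta_controllable)[X Xskew ->].
by rewrite metric_velocity // x0 mul0mx linear0 mulr0.
Qed.

Lemma horizontalB x y :
  horizontal Theta x -> horizontal Theta y -> horizontal Theta (x - y).
Proof.
move=> [xT xV] [yT yV]; split; first exact: tangentB.
by move=> v Vv; rewrite metricBl xV // yV // subrr.
Qed.

(** Skewness of the solution comes from uniqueness: transposing the equation
shows that X^T and - X solve the same one. *)
Lemma skew_solution_unique_exists x : exists! X, skew_solution Theta x X.
Proof.
have [X XE] := normal_op_surj Aspd Theta_controllable (- beta Theta x).
have normal_opE Y : normal_op A B C Y + beta Theta x = 0 -> X = Y.
  move=> /eqP; rewrite addr_eq0 => /eqP YE.
  by apply: (normal_op_inj Aspd Theta_controllable); rewrite XE YE.
have Xskew : X^T = - X.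
  apply: (normal_op_inj Aspd Theta_controllable).
  by rewrite linearN /= -normal_op_tr // XE linearN /= beta_skew.
exists X; case: x XE normal_opE => [[a b] c] XE normal_opE; split=> [|Y [_ YE]].
  by split=> //; apply/eqP; rewrite addr_eq0; apply/eqP.
exact: normal_opE.
Qed.

Lemma skew_solutionE x X : skew_solution Theta x X ->
  X^T = - X /\ normal_op A B C X = - beta Theta x.
Proof.
by case: x => [[a b] c] [Xskew /eqP]; rewrite addr_eq0 => /eqP.
Qed.

Lemma horizontal_add_velocity x X : tangent_N x -> skew_solution Theta x X ->
  horizontal Theta (x + velocity A B C X).
Proof.
move=> xT /skew_solutionE[Xskew XE].
apply/horizontalP.
  by apply: tangentD => //; exact: velocity_tangent.
by rewrite betaD beta_velocity // XE addrN.
Qed.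

(** P x and x + v(X) are both horizontal and both differ from x by vectors
orthogonal to the horizontal space, so their difference is orthogonal to
itself. *)
Lemma projection_formula P x X : is_horizontal_projection Theta P ->
  tangent_N x -> skew_solution Theta x X -> P x = x + velocity A B C X.
Proof.
move=> PE xT Xsol; have [Px_hor Px_orth] := PE x xT.
have x'_hor := horizontal_add_velocity xT Xsol.
have Xskew : X^T = - X by case: Xsol.
apply/eqP; rewrite -subr_eq0; apply/eqP.
set w := x + _ in x'_hor *; set h := _ - _.
have h_hor : horizontal Theta h by exact: horizontalB.
apply: (metric_eq0 (B := B) (C := C) Aspd h_hor.1).
have wx_orth : metric Theta (w - x) h = 0.
  rewrite /w addrAC subrr add0r metricC; apply: h_hor.2.
  exact: velocity_vertical.
move: wx_orth (Px_orth _ h_hor) => /eqP; rewrite metricBl subr_eq0 => /eqP wx.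
move=> /eqP; rewrite metricBl subr_eq0 => /eqP xPx.
by rewrite -[metric _ h h]/(metric Theta (P x - w) h) metricBl wx xPx subrr.
Qed.

Lemma horizontal_projection_exists :
  exists P, is_horizontal_projection Theta P.
Proof.
have [X XE] : {X | forall x, skew_solution Theta x (X x)}.
  exists (fun x => sval (cid (skew_solution_unique_exists x))) => x.
  by case: cid => Y [].
exists (fun x => x + velocity A B C (X x)) => x xT; split.
  exact: horizontal_add_velocity.
move=> h [_ hV].
have -> : metric Theta (x - (x + velocity A B C (X x))) h =
          - metric Theta (velocity A B C (X x)) h.
  rewrite opprD addrA subrr metricBl.
  by rewrite -{1}(subrr x) metricBl subrr sub0r.
rewrite metricC hV ?oppr0 //; apply: velocity_vertical.
by case: (skew_solutionE (XE x)).
Qed.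

End Projection.

Theorem theorem2 (R : realType) (n m p : nat)
    (hn : (1 <= n)%N) (hm : (1 <= m)%N) (hp : (1 <= p)%N)
    (A : 'M[R]_n) (B : 'M[R]_(n, m)) (C : 'M[R]_(p, n))
    (hTheta : manifold_N (A, B, C)) :
  (exists P : triple R n m p -> triple R n m p,
      is_horizontal_projection (A, B, C) P) /\
  (forall P : triple R n m p -> triple R n m p,
     is_horizontal_projection (A, B, C) P ->
     forall (a : 'M[R]_n) (b : 'M[R]_(n, m)) (c : 'M[R]_(p, n)),
       tangent_N (a, b, c) ->
       (exists! X : 'M[R]_n, skew_solution (A, B, C) (a, b, c) X) /\
       (forall X : 'M[R]_n, skew_solution (A, B, C) (a, b, c) X ->
          P (a, b, c) =
          (a, b, c) + (X *m A - A *m X, X *m B, - (C *m X)))).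
Proof.
have [Aspd Tc _] := hTheta.
split; first exact: horizontal_projection_exists.
move=> P PE a b c xT; split; first exact: skew_solution_unique_exists.
by move=> X XE; exact: (projection_formula Aspd Tc PE xT XE).
Qed.
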